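(* Let $m=2^n$ with $n>2$ and let $S=\{1,\frac m2-2,\frac m2\}=\{1,2^{n-1}-2,2^{n-1}\}$. Then the circulant graph $G=C_m(S)$ does not admit an open XOR-magic labeling.
   Context: For $m\ge 4$ and $S\subseteq\{1,2,\ldots,\lfloor m/2\rfloor\}$, the circulant graph $C_m(S)$ has vertices $x_0,\ldots,x_{m-1}$, and distinct $x_i,x_j$ are adjacent if and only if $|i-j|\in\{s,\,m-s : s\in S\}$. For a vertex $x$, $N(x)$ is its set of neighbours. An open XOR-magic labeling of a graph $G=(V,E)$ with $|V|=2^n$ is a bijection $\ell:V\to(\mathbb{Z}_2)^n$ such that $\sum_{y\in N(x)}\ell(y)$ is the zero vector of $(\mathbb{Z}_2)^n$ for every $x\in V$. *)

(* Defs.v *)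
From mathcomp Require Import all_boot all_algebra.

Set Implicit Arguments.
Unset Strict Implicit.
Unset Printing Implicit Defensive.

Import GRing.Theory.
Local Open Scope ring_scope.

(* The graph is meant for 4 <= m and a list S of elements of {1, .., m./2};
   only membership in S matters, not order or repetition. *)
Definition circulant (m : nat) (S : seq nat) : rel 'I_m :=
  fun i j => (i != j) &&
    has (fun s => (`|i - j|%N == s) || (`|i - j|%N == (m - s)%N)) S.

Lemma circulant_sym (m : nat) (S : seq nat) : symmetric (@circulant m S).
Proof. by move=> i j; rewrite /circulant eq_sym distnC. Qed.

Lemma circulant_irr (m : nat) (S : seq nat) : irreflexive (@circulant m S).
Proof. by move=> i; rewrite /circulant eqxx. Qed.

Definition neighbours (T : finType) (e : rel T) (x : T) : {set T} :=
  [set y | e x y].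

(* Bijectivity of l already forces #|T| = 2 ^ n. *)
Definition open_xor_magic (T : finType) (e : rel T) (n : nat)
    (l : T -> 'rV['F_2]_n) : Prop :=
  bijective l /\ forall x : T, \sum_(y in neighbours e x) l y = 0.

(* Main.v *)
Require Import Defs.
From mathcomp Require Import all_boot all_algebra.
From mathcomp Require Import zify.

Import GRing.Theory.

(** In [F_2[x] / (x^m - 1)] the connection polynomial [p] of the graph has five
    terms, and [p(x)^m = p(x^m) = p(1) = 1] because [m] is a power of two.
    Hence [p] acts invertibly on labelings, so a labeling whose neighbourhood
    sums all vanish is zero. *)

Section CharacteristicTwo.

Local Open Scope ring_scope.

Variable V : zmodType.
Hypothesis addvv : forall v : V, v + v = 0.

(* The Frobenius identity: the off-diagonal terms cancel in pairs. *)
Lemma sum_sum_add_char2 (D : seq nat) (F : nat -> V) :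
  \sum_(d <- D) \sum_(e <- D) F (d + e)%N = \sum_(d <- D) F (d + d)%N.
Proof.
elim: D => [|a D IH]; first by rewrite !big_nil.
rewrite !big_cons; under [X in _ + X]eq_bigr do rewrite big_cons.
rewrite big_split /= IH -addrA; congr (_ + _).
by under [X in _ + (X + _)]eq_bigr do rewrite addnC; rewrite addrA addvv add0r.
Qed.

(** Repeated squaring: applying the operator with shifts [2 ^ k * d] twice gives the one with shifts
    [2 ^ k.+1 * d]. *)
Lemma sum_shift_expn2 (D : seq nat) (f : nat -> V) (k : nat) :
  (forall i, \sum_(d <- D) f (i + d)%N = 0) ->
  forall i, \sum_(d <- D) f (i + 2 ^ k * d)%N = 0.
Proof.
move=> f0; elim: k => [|k IH] i.
  by under eq_bigr do rewrite expn0 mul1n.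
pose F j := f (i + 2 ^ k * j)%N.
have -> : \sum_(d <- D) f (i + 2 ^ k.+1 * d)%N = \sum_(d <- D) F (d + d)%N.
  by apply: eq_bigr => d _; rewrite /F addnn -mul2n expnS mulnCA mulnA.
(* Restoring the off-diagonal terms makes each inner sum an instance of [IH] based at
   [i + 2 ^ k * d]. *)
rewrite -sum_sum_add_char2 big1 // => d _; rewrite /F.
by under eq_bigr do rewrite mulnDr addnA; apply: IH.
Qed.

(** At [k = n] every shift is a multiple of the period, so the vanishing sum consists of [size D]
    copies of [f i]; an odd number of copies adds up to [f i]. *)
Lemma periodic_odd_sum_eq0 (D : seq nat) (f : nat -> V) (n : nat) :
  odd (size D) -> (forall i d, f (i + 2 ^ n * d)%N = f i) ->
  (forall i, \sum_(d <- D) f (i + d)%N = 0) -> forall i, f i = 0.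
Proof.
move=> oddD perf f0 i; have := sum_shift_expn2 D f n f0 i.
under eq_bigr do rewrite perf.
rewrite big_const_seq count_predT iter_addr addr0 -(odd_double_half (size D)).
by rewrite oddD mulrS -mul2n mulrnA mulr2n addvv mul0rn addr0.
Qed.

End CharacteristicTwo.

Lemma eqn_modD_lt (m x y d : nat) : x < m -> y < m -> d < m ->
  (y == (x + d) %% m) = if x <= y then d == y - x else d == m - (x - y).
Proof.
move=> ltx lty ltd; have [lem|ltm] := leqP m (x + d).
  by rewrite -{1}(subnK lem) modnDr modn_small; case: leqP; lia.
by rewrite modn_small //; case: leqP; lia.
Qed.

(** Modulo [h.*2] these are 1 and -1, [h - 2] and its negative, and [h], which is its own negative:
    hence an odd count. *)
Definition offsets (h : nat) : seq nat := [:: 1; h.*2 - 1; h - 2; h + 2; h].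

Section Neighbourhood.

Variable h : nat.
Hypothesis h_gt3 : 3 < h.
Let m := h.*2.
Let m_gt0 : 0 < m. Proof. by rewrite /m; lia. Qed.

Definition residue (i : nat) : 'I_m := Ordinal (ltn_pmod i m_gt0).

Lemma offsets_lt d : d \in offsets h -> d < m.
Proof. by rewrite !inE /m; lia. Qed.

Lemma perm_neighbours_offsets (x : 'I_m) :
  perm_eq (enum (neighbours (@circulant m [:: 1; h - 2; h]) x))
          [seq residue (x + d) | d <- offsets h].
Proof.
apply: uniq_perm; first exact: enum_uniq.
  (* The bound [3 < h] keeps the five offsets distinct: at [h = 3], [h - 2] would meet 1. *)
  rewrite map_inj_in_uniq; first by rewrite /= !inE; lia.
  move=> d e /offsets_lt ltd /offsets_lt lte /(congr1 val) /= /eqP.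
  by rewrite eqn_modDl !modn_small // => /eqP.
move=> y; rewrite mem_enum inE /circulant /= !inE -!val_eqE /=.
have ltx := ltn_ord x; have lty := ltn_ord y.
rewrite !eqn_modD_lt //; try by rewrite /m; lia.
move: ltx lty; rewrite /m; move: (val x) (val y) => a b lta ltb.
case: leqP => [leab|/ltnW leba].
  rewrite distnEr //.
  (* Both sides then depend on [a] and [b] only through their difference, which is generalized to
     [k]. *)
  have -> : (a != b) = (b - a != 0) by lia.
  have : b - a < h.*2 by lia.
  by move: (b - a) => k ltk; clear -h_gt3 ltk; lia.
rewrite distnEl //.
have -> : (a != b) = (a - b != 0) by lia.
have : a - b < h.*2 by lia.
by move: (a - b) => k ltk; clear -h_gt3 ltk; lia.
Qed.

End Neighbourhood.

Theorem theorem4 (n m : nat) (hn : 2 < n) (hm : m = 2 ^ n) :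
  ~ exists l : 'I_m -> 'rV['F_2]_n,
      open_xor_magic (@circulant m [:: 1; m %/ 2 - 2; m %/ 2]) l.
Proof.
case=> l [l_bij l0].
pose h := 2 ^ n.-1.
have mE : m = h.*2 by rewrite hm -mul2n -expnS prednK //; lia.
have h_gt3 : 3 < h by rewrite /h (@leq_exp2l 2 2) //; lia.
move: hm l l_bij l0; have -> : m %/ 2 = h by rewrite mE; lia.
move: mE => -> hm l l_bij l0; pose f i := l (residue h h_gt3 i).
have l_eq0 x : l x = 0%R.
  have <- : residue h h_gt3 x = x by apply: val_inj; rewrite /= modn_small.
  apply: (periodic_odd_sum_eq0 _ _ (offsets h) f n) => // [v|i d|i].
  - by apply/rowP => j; rewrite !mxE addrr_pchar2 // pchar_Fp.
  - by congr l; apply: val_inj; rewrite /= -hm addnC mulnC modnMDl.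
  - rewrite -[RHS](l0 (residue h h_gt3 i)) -[RHS]big_enum.
    rewrite (perm_big _ (perm_neighbours_offsets h h_gt3 _)) big_map.
    by apply: eq_bigr => d _; congr l; apply: val_inj; rewrite /= modnDml.
(* A zero labeling is not injective, as 0 and 1 are distinct vertices. *)
have l01 : l (residue h h_gt3 0) = l (residue h h_gt3 1) by rewrite !l_eq0.
have /(congr1 val) := bij_inj l_bij l01.
by rewrite /= mod0n modn_small //; lia.
Qed.
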